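(* Let $D$ be a countable dense subset of $\mathbb{R}$, let $(I,\le)$ be a directed set, let $U\subseteq C$, and let $Z$ and $Z_\alpha$, $\alpha\in I$, be convex stochastic processes in $U$ defined on a probability space $(\Omega,\mathcal{A},\mathbb{P})$. Suppose that the finite dimensional distributions converge on $D$, i.e. for every $k\in\mathbb{N}$ and all $t_1,\dots,t_k\in D$, $(Z_\alpha(t_1),\dots,Z_\alpha(t_k))\stackrel{\mathcal{D}}{\to}(Z(t_1),\dots,Z(t_k))$ in $\mathbb{R}^k$ with its usual topology. Then: (1) If $U=S$, then $\sigma(Z_\alpha)\stackrel{\mathcal{D}}{\to}\sigma(Z)$ in $(\mathbb{R},\mathcal{O}_>)$. If in addition $Z$ is a process in $S^*$ with $Z\in S_u$ a.s., then $\sigma(Z_\alpha)\stackrel{\mathcal{D}}{\to}\sigma(Z)$ in $(\mathbb{R},\mathcal{O}_n)$. (2) If $U=S'$, then $\tau(Z_\alpha)\stackrel{\mathcal{D}}{\to}\tau(Z)$ in $(\mathbb{R},\mathcal{O}_<)$. If in addition $Z$ is a process in $S^*$ with $Z\in S_u$ a.s., then $\tau(Z_\alpha)\stackrel{\mathcal{D}}{\to}\tau(Z)$ in $(\mathbb{R},\mathcal{O}_n)$. (3) If $U=S^*$ and $\xi:S^*\to\mathbb{R}$ is any measurable selection of $A$, then $\xi(Z_\alpha)\stackrel{\mathcal{D}}{\to}\sigma(Z)$ in $(\mathbb{R},\mathcal{O}_>)$ and $\xi(Z_\alpha)\stackrel{\mathcal{D}}{\to}\tau(Z)$ in $(\mathbb{R},\mathcal{O}_<)$.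 If in addition $\sigma(Z)$ and $\tau(Z)$ have the same distribution, then $\xi(Z_\alpha)\stackrel{\mathcal{D}}{\to}\sigma(Z)$ in $(\mathbb{R},\mathcal{O}_n)$.
   Context: $C$ is the set of all convex functions $f:\mathbb{R}\to\mathbb{R}$; $A(f)=\{t\in\mathbb{R}: f(t)=\inf_{s\in\mathbb{R}} f(s)\}$. $S=\{f\in C: A(f)\neq\emptyset,\ \inf A(f)>-\infty\}$, $S'=\{f\in C: A(f)\ne\emptyset,\ \sup A(f)<\infty\}$, $S^*=S\cap S'$, $S_u=\{f\in C: f\text{ has a unique minimizing point}\}$; $\sigma(f)=\min A(f)$ for $f\in S$ and $\tau(f)=\max A(f)$ for $f\in S'$. $\mathcal{C}$ is the $\sigma$-algebra on $C$ generated by the evaluations $f\mapsto f(t)$, $t\in\mathbb{R}$. A measurable selection of $A$ is a map $\xi:S^*\to\mathbb{R}$ that is Borel measurable with respect to the trace $\sigma$-algebra $S^*\cap\mathcal{C}$ and satisfies $\xi(f)\in A(f)$ for all $f\in S^*$. A convex stochastic process is a map $Z:\Omega\to C$ such that $Z(t):\omega\mapsto Z(\omega)(t)$ is a real random variable for every $t\in\mathbb{R}$; it is a process in $U\subseteq C$ if $Z(\omega)\in U$ for all $\omega\in\Omega$. $\mathcal{O}_n$ is the natural topology on $\mathbb{R}$, $\mathcal{O}_<=\{(-\infty,x):x\in\mathbb{R}\}\cup\{\emptyset,\mathbb{R}\}$, $\mathcal{O}_>=\{(x,\infty):x\in\mathbb{R}\}\cup\{\emptyset,\mathbb{R}\}$.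 For random variables $Y,Y_\alpha$ ($\alpha\in I$) on $(\Omega,\mathcal{A},\mathbb{P})$ with values in a topological space $(X,\mathcal{O})$ (measurable with respect to $\sigma(\mathcal{O})$), $Y_\alpha\stackrel{\mathcal{D}}{\to}Y$ in $(X,\mathcal{O})$ means $\liminf_\alpha\mathbb{P}(Y_\alpha\in O)\ge\mathbb{P}(Y\in O)$ for all $O\in\mathcal{O}$. *)

(* Defs.v *)
From HB Require Import structures.
From mathcomp Require Import all_boot all_order all_algebra.
From mathcomp Require Import all_classical all_reals all_analysis.
From mathcomp Require Import ring lra.

Set Implicit Arguments.
Unset Strict Implicit.
Unset Printing Implicit Defensive.

Import Order.TTheory GRing.Theory Num.Theory.
Import numFieldNormedType.Exports.

Local Open Scope classical_set_scope.
Local Open Scope ring_scope.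

Section ConvexFunctions.
Context {R : realType}.
Implicit Types f : R -> R.

Definition convex_functions : set (R -> R) :=
  [set f | @convex_function R R^o [set: R] f].

(* The infimum is taken in \bar R: the real-valued inf is 0 on sets that are
   not bounded below, which would create spurious minimizers. *)
Definition minimizers f : set R :=
  [set t | (f t)%:E = ereal_inf [set (f s)%:E | s in [set: R]]].

Definition S_inf : set (R -> R) :=
  [set f | [/\ convex_functions f, minimizers f !=set0 &
               (-oo < ereal_inf [set t%:E | t in minimizers f])%E]].

Definition S_sup : set (R -> R) :=
  [set f | [/\ convex_functions f, minimizers f !=set0 &
               (ereal_sup [set t%:E | t in minimizers f] < +oo)%E]].

Definition S_star : set (R -> R) := S_inf `&` S_sup.

Definition S_uniq : set (R -> R) :=
  [set f | convex_functions f /\ exists! t, minimizers f t].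

(* The value 0 is only reached when minimizers f has no least (greatest)
   element, which does not happen on S_inf (S_sup): see sigma_minP, tau_maxP. *)
Definition sigma_min f : R := xget 0 (minimizers f `&` lbound (minimizers f)).
Definition tau_max f : R := xget 0 (minimizers f `&` ubound (minimizers f)).

(* This is a sigma-algebra on the set convex_functions (not on R -> R). *)
Definition sigma_eval : set (set (R -> R)) :=
  <<s convex_functions,
      \bigcup_(t in [set: R])
        preimage_set_system convex_functions (fun f => f t) measurable >>.

(* Only the restriction of xi to S_star matters. *)
Definition measurable_selection (xi : (R -> R) -> R) : Prop :=
  (forall B : set R, measurable B ->
     strace sigma_eval S_star (S_star `&` xi @^-1` B)) /\
  (forall f, S_star f -> minimizers f (xi f)).

Definition O_natural : set (set R) := open.
Definition O_less : set (set R) :=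
  [set `]-oo, x[%classic | x in [set: R]] `|` [set set0; [set: R]].
Definition O_greater : set (set R) :=
  [set `]x, +oo[%classic | x in [set: R]] `|` [set set0; [set: R]].

End ConvexFunctions.

Definition convex_process d (Omega : measurableType d) (R : realType)
    (U : set (R -> R)) (Z : Omega -> R -> R) : Prop :=
  [/\ forall w, convex_functions (Z w),
      forall t, measurable_fun [set: Omega] (fun w => Z w t) &
      forall w, U (Z w)].

Definition directed_set (I : Type) (le : I -> I -> Prop) : Prop :=
  [/\ inhabited I,
      forall i, le i i,
      forall i j k, le i j -> le j k -> le i k &
      forall i j, exists k, le i k /\ le j k].

(* The filter-based limf_einf of the library needs a choiceType with a
   canonical filter; this is the same quantity for the filter of tails. *)
Definition net_liminf (R : realType) (I : Type) (le : I -> I -> Prop)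
    (x : I -> \bar R) : \bar R :=
  ereal_sup [set ereal_inf [set x j | j in le i] | i in [set: I]].

Definition measurable_wrt d (Omega : measurableType d) (X : Type)
    (O : set (set X)) (Y : Omega -> X) : Prop :=
  forall B, <<s O >> B -> measurable (Y @^-1` B).

(* Measurability of all maps involved is part of the notion. *)
Definition cvg_distribution d (Omega : measurableType d) (R : realType)
    (P : probability Omega R) (I : Type) (le : I -> I -> Prop)
    (X : Type) (O : set (set X)) (Ya : I -> Omega -> X) (Y : Omega -> X)
    : Prop :=
  [/\ forall a, measurable_wrt O (Ya a),
      measurable_wrt O Y &
      forall G, O G ->
        (P (Y @^-1` G) <= net_liminf le (fun a => P (Ya a @^-1` G)))%E].

Definition same_distribution d (Omega : measurableType d) (R : realType)
    (P : probability Omega R) (Y Y' : Omega -> R) : Prop :=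
  forall B : set R, measurable B -> P (Y @^-1` B) = P (Y' @^-1` B).

Section Attainment.
Context {R : realType}.
Implicit Types f : R -> R.

Lemma minimizersP f t : minimizers f t <-> forall s, f t <= f s.
Proof.
split=> [ft s|ft].
  by rewrite -lee_fin ft; apply: ereal_inf_lbound; exists s.
apply/eqP; rewrite eq_le; apply/andP; split.
  by apply: le_ereal_inf_tmp => _ [s _ <-]; rewrite lee_fin.
by apply: ereal_inf_lbound; exists t.
Qed.

Lemma minimizers_adherent f a c : convex_functions f ->
  (forall e, 0 < e -> exists x,
     [/\ 0 <= x, x < e & minimizers f (a + c * x)]) -> minimizers f a.
Proof.
move=> cf H; apply/minimizersP => s; apply/ler_addgt0Pr => e e0.
pose K := `|f (a - c) - f s| + 1.
have K0 : 0 < K by rewrite ltr_wpDl.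
have [x [x0 xe /minimizersP mx]] := H _ (divr_gt0 e0 K0).
have x1 : 0 < 1 + x by rewrite ltr_pwDl.
have p01 : 0 <= (1 + x)^-1 <= 1.
  by rewrite invr_ge0 (ltW x1)/= invf_le1// lerDl.
have p0 : 0 <= (1 + x)^-1 by case/andP: p01.
have p1 : (1 + x)^-1 <= 1 by case/andP: p01.
have := cf (Itv01 p0 p1) (a + c * x) (a - c) (mem_set I) (mem_set I).
rewrite !convRE /= /unstable.onem => h.
have E : (1 + x)^-1 * (a + c * x) + (1 - (1 + x)^-1) * (a - c) = a.
  by field; rewrite gt_eqF.
have {}h : f a <= (1 + x)^-1 * f (a + c * x) + (1 - (1 + x)^-1) * f (a - c).
  by rewrite -[X in f X <= _]E.
apply: (le_trans h).
have hs := mx s.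
have hb : f (a - c) <= f s + K.
  by have := ler_norm (f (a - c) - f s); rewrite /K; lra.
have xK : x * K < e by rewrite -ltr_pdivlMr.
have q0 : 0 <= 1 - (1 + x)^-1 by rewrite subr_ge0.
have qx : 1 - (1 + x)^-1 <= x.
  have -> : 1 - (1 + x)^-1 = x * (1 + x)^-1 by field; rewrite gt_eqF.
  by rewrite ler_piMr.
have h1 := ler_wpM2l p0 hs.
have h2 := ler_wpM2l q0 hb.
have h3 := ler_wpM2r (ltW K0) qx.
lra.
Qed.

Lemma sigma_minP f : S_inf f ->
  (minimizers f `&` lbound (minimizers f)) (sigma_min f).
Proof.
move=> [cf A0 Ainf]; apply: xgetPex.
have lbA : has_lbound (minimizers f).
  case E : (ereal_inf [set t%:E | t in minimizers f]) Ainf => [r| |] // _.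
    exists r => t At; rewrite -lee_fin -E.
    by apply: ereal_inf_lbound; exists t.
  case: A0 => t0 At0; exfalso.
  have : (ereal_inf [set t%:E | t in minimizers f] <= t0%:E)%E.
    by apply: ereal_inf_lbound; exists t0.
  by rewrite E.
have hA : has_inf (minimizers f) by [].
exists (inf (minimizers f)); split; last by move=> t At; exact: ge_inf.
apply: (@minimizers_adherent f _ 1) => // e e0.
have [t At te] := inf_adherent e0 hA.
exists (t - inf (minimizers f)); split.
- by rewrite subr_ge0; exact: ge_inf.
- by rewrite ltrBlDl.
- by rewrite mul1r addrC subrK.
Qed.

Lemma tau_maxP f : S_sup f ->
  (minimizers f `&` ubound (minimizers f)) (tau_max f).
Proof.
move=> [cf A0 Asup]; apply: xgetPex.
have ubA : has_ubound (minimizers f).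
  case E : (ereal_sup [set t%:E | t in minimizers f]) Asup => [r| |] // _.
    exists r => t At; rewrite -lee_fin -E.
    by apply: ereal_sup_ubound; exists t.
  case: A0 => t0 At0; exfalso.
  have : (t0%:E <= ereal_sup [set t%:E | t in minimizers f])%E.
    by apply: ereal_sup_ubound; exists t0.
  by rewrite E.
have hA : has_sup (minimizers f) by [].
exists (sup (minimizers f)); split; last by move=> t At; exact: ub_le_sup.
apply: (@minimizers_adherent f _ (-1)) => // e e0.
have [t At te] := sup_adherent e0 hA.
exists (sup (minimizers f) - t); split.
- by rewrite subr_ge0; exact: ub_le_sup.
- by rewrite ltrBlDr -ltrBlDl.
- by rewrite mulN1r subKr.
Qed.

End Attainment.

(* Main.v *)
Require Import Defs.
From mathcomp Require Import all_boot all_order all_algebra.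
From mathcomp Require Import all_classical all_reals all_analysis.
From mathcomp Require Import measurable_realfun ring lra.
Set Implicit Arguments.
Unset Strict Implicit.
Unset Printing Implicit Defensive.

Import Order.TTheory GRing.Theory Num.Theory.
Import numFieldNormedType.Exports.

Local Open Scope classical_set_scope.
Local Open Scope ring_scope.

(** Convexity turns statements about minimizers into statements about finitely
many values of the function.  Say that [f] drops from [p] to [q] if
[f q < f p].  If a convex [f] drops from [p] to some [q > p], then all its
minimizers lie to the right of [p] ([minimizer_right_of_drop]): a minimizer
[m <= p] would give [f m <= f q < f p], against convexity on [m, q].
Conversely a convex function is strictly decreasing up to its least minimizer,
so that for every dense set [D], [x < sigma_min f] holds exactly if [f] drops
between two points [x < p < q] of [D] ([sigma_min_gtP]).  The mirror images
characterize [tau_max f < x] ([tau_max_ltP]).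

For countable [D] the event [x < sigma_min Z] is therefore a countable union of
events [Z q < Z p].  Each finite part of this union is an open condition on a
finite dimensional marginal of [Z], so convergence of the marginals bounds its
probability by the liminf of the probabilities for [Za]; continuity from below
passes the bound to the whole union ([tail_ge_drop_event]).  A drop of [Za] to
the right of [x] forces any minimizer of [Za] above [x], whichever one is
selected.  Hence, for arbitrary measurable minimizers [X a] of [Za a],
  P (x < sigma_min Z) <= liminf P (x < X a)  and
  P (tau_max Z < x)  <= liminf P (X a < x)
([tail_ge_sigma_min], [tail_ge_tau_max]); these are the two one-sided
convergences, for the selections [sigma_min], [tau_max] and [xi] alike.

If [sigma_min Z] and [tau_max Z] have the same law, which holds in particular
if the minimizer is almost surely unique ([same_distribution_uniq]), both
bounds concern one limit [Y].  They then hold for bounded open intervals,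
because P (a < Y < b) = P (a < Y) + P (Y < b) - 1, and for open sets, which are
disjoint unions of open intervals, because liminf is superadditive
([tail_bound_open]). *)

(** * Lower bounds for the limit inferior of a net *)

Section TailBounds.
Context {R : realType} {I : Type} (le : I -> I -> Prop).
Hypothesis dir : directed_set le.
Implicit Types (x y : I -> R) (c : R).

(** The inequality [c <= liminf x] in terms of real numbers, so that sums and
linear arithmetic do not meet infinite values. *)
Definition tail_ge x c :=
  forall e, 0 < e -> exists i, forall j, le i j -> c - e <= x j.

Lemma net_liminf_geP x c :
  (c%:E <= net_liminf le (fun i => (x i)%:E))%E <-> tail_ge x c.
Proof.
split=> [cx e e0|cx].
  have : ((c - e)%:E < net_liminf le (fun i => (x i)%:E))%E.
    by apply: lt_le_trans cx; rewrite lte_fin ltrBlDr ltrDl.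
  move=> /ereal_sup_gt[_ [i _ <-]] /ltW h; exists i => j ij.
  rewrite -lee_fin; apply: (Order.POrderTheory.le_trans h).
  by apply: ereal_inf_lbound; exists j.
apply/lee_addgt0Pr => e e0; rewrite -leeBlDr//.
have [i hi] := cx _ e0.
apply: Order.POrderTheory.le_trans (ereal_sup_ubound _); last by exists i.
apply: le_ereal_inf_tmp => _ [j ij <-].
by rewrite -EFinB lee_fin; exact: hi.
Qed.

Lemma tail_ge_mono x y c : (forall i, x i <= y i) -> tail_ge x c -> tail_ge y c.
Proof.
move=> xy xc e e0; have [i hi] := xc e e0; exists i => j ij.
exact: le_trans (hi _ ij) (xy j).
Qed.

Lemma tail_ge_cst x c : (forall i, c <= x i) -> tail_ge x c.
Proof.
case: dir => -[i0] _ _ _ cx e e0; exists i0 => j _.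
by apply: le_trans (cx j); rewrite lerBlDr lerDl ltW.
Qed.

Lemma tail_geD x y c c' :
  tail_ge x c -> tail_ge y c' -> tail_ge (fun i => x i + y i) (c + c').
Proof.
case: dir => _ _ tr up xc yc e e0.
have e20 : 0 < e / 2 by rewrite divr_gt0.
have [i hi] := xc _ e20; have [j hj] := yc _ e20.
have [k [ik jk]] := up i j; exists k => l kl.
have := hi _ (tr _ _ _ ik kl); have := hj _ (tr _ _ _ jk kl); lra.
Qed.

Lemma tail_ge_sum (x : nat -> I -> R) (c : nat -> R) n :
  (forall k, tail_ge (x k) (c k)) ->
  tail_ge (fun i => \sum_(k < n) x k i) (\sum_(k < n) c k).
Proof.
move=> xc; elim: n => [|n IH].
  by rewrite big_ord0; apply: tail_ge_cst => i; rewrite big_ord0.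
rewrite big_ord_recr/=.
apply: tail_ge_mono (tail_geD IH (xc n)) => i.
by rewrite [leRHS]big_ord_recr.
Qed.

Lemma tail_ge_approx x c :
  (forall e, 0 < e -> exists2 c', c - e <= c' & tail_ge x c') -> tail_ge x c.
Proof.
move=> H e e0; have e20 : 0 < e / 2 by rewrite divr_gt0.
have [c' cc' xc'] := H _ e20; have [i hi] := xc' _ e20.
by exists i => j ij; have := hi _ ij; lra.
Qed.

End TailBounds.

(** * Real-valued probabilities *)

Section Probabilities.
Context {d} {Omega : measurableType d} {R : realType} (P : probability Omega R).
Implicit Types A B : set Omega.

Local Notation Pr A := (fine (P A)).

Lemma EFin_prob A : measurable A -> P A = (fine (P A))%:E.
Proof. by move=> mA; rewrite fineK// fin_num_measure. Qed.

Lemma fine_prob_le A B :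
  measurable A -> measurable B -> A `<=` B -> Pr A <= Pr B.
Proof.
move=> mA mB AB; apply: fine_le; rewrite ?fin_num_measure//.
by apply: le_measure => //; rewrite inE.
Qed.

Lemma fine_prob_setI A B : measurable A -> measurable B -> A `|` B = setT ->
  Pr (A `&` B) = Pr A + Pr B - 1.
Proof.
move=> mA mB AB.
have mI : measurable (A `&` B) by exact: measurableI.
have E : P (A `|` B) = (P A + P B - P (A `&` B))%E.
  apply: measureUfinl => //.
  exact: Order.POrderTheory.le_lt_trans (probability_le1 P mA) (ltry 1).
rewrite AB probability_setT (EFin_prob mA) (EFin_prob mB) (EFin_prob mI) in E.
by case: E => ->; ring.
Qed.

Lemma fine_prob_bigcup_approx (F : nat -> set Omega) (e : R) :
  (forall n, measurable (F n)) -> 0 < e ->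
  exists n, Pr (\bigcup_n F n) - e <= Pr (\big[setU/set0]_(k < n) F k).
Proof.
move=> mF e0; pose G n := \big[setU/set0]_(k < n) F k.
have mG n : measurable (G n) by exact: bigsetU_measurable.
have GF : \bigcup_n G n = \bigcup_n F n.
  apply/seteqP; split=> [w [n _]|w [n _ Fw]]; first exact: bigsetU_bigcup.
  by exists n.+1 => //; rewrite /G big_ord_recr; right.
have mU : measurable (\bigcup_n G n) by exact: bigcup_measurable.
have /fine_cvgP[_] : P (G n) @[n --> \oo] --> (Pr (\bigcup_n F n))%:E.
  rewrite -GF -EFin_prob//; apply: nondecreasing_cvg_mu => // n m nm.
  by apply/subsetPset; exact: subset_bigsetU.
move=> /cvgrPdist_le /(_ e e0)[n _ /(_ n (leqnn n))/=].
by rewrite ler_norml => /andP[_ h]; exists n; rewrite lerBlDr -lerBlDl.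
Qed.

Lemma fine_prob_bigsetU (F : nat -> set Omega) n :
  (forall n, measurable (F n)) -> trivIset setT F ->
  Pr (\big[setU/set0]_(k < n) F k) = \sum_(k < n) Pr (F k).
Proof.
move=> mF tF.
have -> : P (\big[setU/set0]_(k < n) F k) = (\sum_(k < n) P (F k))%E.
  by apply: measure_semi_additive => //; exact: bigsetU_measurable.
rewrite (eq_bigr (fun k : 'I_n => (Pr (F k))%:E)) => [|k _].
  by rewrite sumEFin.
exact: EFin_prob.
Qed.

End Probabilities.

(** * Convergence in distribution from bounds on half-lines *)

Section RealConvergence.
Context {d} {Omega : measurableType d} {R : realType} (P : probability Omega R).
Context {I : Type} (le : I -> I -> Prop).
Hypothesis dir : directed_set le.
Variables (Y : Omega -> R) (Ya : I -> Omega -> R).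
Hypothesis mY : measurable_fun setT Y.
Hypothesis mYa : forall a, measurable_fun setT (Ya a).

Let tail_bound (G : set R) :=
  tail_ge le (fun a => fine (P (Ya a @^-1` G))) (fine (P (Y @^-1` G))).

Lemma measurable_preimage (X : Omega -> R) (B : set R) :
  measurable_fun setT X -> measurable B -> measurable (X @^-1` B).
Proof. by move=> mX mB; rewrite -[X in measurable X]setTI; exact: mX. Qed.

Lemma cvg_distribution_of_tail_bound (O : set (set R)) :
  O `<=` measurable -> (forall G, O G -> tail_bound G) ->
  cvg_distribution P le O Ya Y.
Proof.
move=> mO bO.
have mwrt (X : Omega -> R) : measurable_fun setT X -> measurable_wrt O X.
  move=> mX B OB; apply: measurable_preimage => //.
  by apply: smallest_sub OB => //; exact: sigma_algebra_measurable.
split=> [a||G OG]; [exact: mwrt|exact: mwrt|].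
have mG := mO _ OG.
rewrite EFin_prob; last exact: measurable_preimage.
rewrite (_ : (fun a => P (Ya a @^-1` G)) =
             (fun a => (fine (P (Ya a @^-1` G)))%:E)); last first.
  by apply/funext => a; rewrite EFin_prob//; exact: measurable_preimage.
by apply/net_liminf_geP; exact: bO.
Qed.

Lemma tail_bound_set0 : tail_bound set0.
Proof. by apply: tail_ge_cst => // a; rewrite !preimage_set0. Qed.

Lemma tail_bound_setT : tail_bound setT.
Proof. by apply: tail_ge_cst => // a; rewrite !preimage_setT. Qed.

Hypothesis Ygt : forall x, tail_bound `]x, +oo[.

Lemma cvg_distribution_greater : cvg_distribution P le O_greater Ya Y.
Proof.
apply: cvg_distribution_of_tail_bound => G [[x _ <-]|[->|->]] //.
- exact: tail_bound_set0.
- exact: tail_bound_setT.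
Qed.

Hypothesis Ylt : forall x, tail_bound `]-oo, x[.

Lemma cvg_distribution_less : cvg_distribution P le O_less Ya Y.
Proof.
apply: cvg_distribution_of_tail_bound => G [[x _ <-]|[->|->]] //.
- exact: tail_bound_set0.
- exact: tail_bound_setT.
Qed.

(** The two rays cover the line, so inclusion-exclusion gives the probability of
their intersection with a plus sign in front of both rays; with a minus sign
the lower bounds would be of no use. *)
Lemma tail_bound_itvoo (a b : R) : tail_bound `]a, b[.
Proof.
have [ba|ab] := leP b a.
  by rewrite set_itv_ge ?bnd_simp -?leNgt//; exact: tail_bound_set0.
have cover (X : Omega -> R) : X @^-1` `]a, +oo[ `|` X @^-1` `]-oo, b[ = setT.
  apply/seteqP; split=> // w _ /=; rewrite !in_itv/= andbT.
  by case: (ltP a (X w)) => [|Xa]; [left|right; exact: le_lt_trans ab].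
have split (X : Omega -> R) : measurable_fun setT X ->
  fine (P (X @^-1` `]a, b[)) =
  fine (P (X @^-1` `]a, +oo[)) + fine (P (X @^-1` `]-oo, b[)) + -1.
  move=> mX; rewrite -fine_prob_setI//; try exact: measurable_preimage.
  congr (fine (P _)); apply/seteqP.
  by split=> w /=; rewrite !in_itv/= andbT => /andP.
rewrite /tail_bound split//.
apply: (@tail_ge_mono _ _ _ (fun i => fine (P (Ya i @^-1` `]a, +oo[)) +
  fine (P (Ya i @^-1` `]-oo, b[)) + -1)) => [i|]; first by rewrite split.
apply: tail_geD => //; first exact: (tail_geD dir (Ygt a) (Ylt b)).
exact: tail_ge_cst.
Qed.

Lemma tail_bound_interval (J : set R) : open J -> is_interval J -> tail_bound J.
Proof.
move=> /interior_id oJ iJ.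
have [lJ|lJ] := pselect (has_lbound J); have [uJ|uJ] := pselect (has_ubound J).
- rewrite -oJ interval_bounded_interior//.
  rewrite (_ : [set _ | _] = `]inf J, sup J[%classic).
    exact: tail_bound_itvoo.
  by apply/seteqP; split=> x /=; rewrite in_itv.
- rewrite -oJ interval_right_unbounded_interior//.
  rewrite (_ : [set _ | _] = `]inf J, +oo[%classic); first exact: Ygt.
  by apply/seteqP; split=> x /=; rewrite in_itv/= andbT.
- rewrite -oJ interval_left_unbounded_interior//.
  rewrite (_ : [set _ | _] = `]-oo, sup J[%classic); first exact: Ylt.
  by apply/seteqP; split=> x /=; rewrite in_itv.
- rewrite (interval_unbounded_setT iJ lJ uJ); exact: tail_bound_setT.
Qed.

(** Finitely many of the disjoint intervals that make up [G] carry all but [e]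
of the mass of [Y] in [G], and lower bounds add up over disjoint sets. *)
Lemma tail_bound_open (G : set R) : open G -> tail_bound G.
Proof.
move=> oG; pose J := open_disjoint_itv oG.
have mJ k : measurable (J k).
  by apply: open_measurable; exact: open_disjoint_itv_open.
have mJX k (X : Omega -> R) : measurable_fun setT X -> measurable (X @^-1` J k).
  by move=> mX; exact: measurable_preimage.
have mG (X : Omega -> R) : measurable_fun setT X -> measurable (X @^-1` G).
  by move=> mX; apply: measurable_preimage => //; exact: open_measurable.
have GJ (X : Omega -> R) : X @^-1` G = \bigcup_k X @^-1` J k.
  by rewrite -preimage_bigcup -open_disjoint_itv_bigcup.
have dJ : trivIset setT J := @open_disjoint_itv_trivIset R G oG.
have tJ (X : Omega -> R) : trivIset setT (fun k => X @^-1` J k).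
  move=> i j _ _ [w [Ji Jj]].
  by apply: (dJ i j Logic.I Logic.I); exists (X w).
apply: tail_ge_approx => e e0.
have [n hn] := fine_prob_bigcup_approx P (fun k => mJX k _ mY) e0.
rewrite -GJ in hn; eexists; first exact: hn.
rewrite (fine_prob_bigsetU P n (fun k => mJX k _ mY) (tJ Y)).
apply: (@tail_ge_mono _ _ _
  (fun a => \sum_(k < n) fine (P (Ya a @^-1` J k)))).
  move=> a; rewrite -(fine_prob_bigsetU P n (fun k => mJX k _ (mYa a)))//.
  apply: fine_prob_le; [|exact: mG|by rewrite GJ; exact: bigsetU_bigcup].
  by apply: bigsetU_measurable => k _; exact: mJX.
apply: (@tail_ge_sum _ _ _ dir (fun k a => fine (P (Ya a @^-1` J k)))
  (fun k => fine (P (Y @^-1` J k)))) => k.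
apply: tail_bound_interval.
- exact: open_disjoint_itv_open.
- exact: open_disjoint_itv_is_interval.
Qed.

Lemma cvg_distribution_natural : cvg_distribution P le O_natural Ya Y.
Proof.
apply: cvg_distribution_of_tail_bound => G oG; first exact: open_measurable.
exact: tail_bound_open.
Qed.

End RealConvergence.

(** * Minimizers of convex functions and drops *)

Section ConvexDrops.
Context {R : realType}.
Implicit Types (f : R -> R) (D : set R).

Lemma convex_three_points f a c b : convex_functions f -> a <= c -> c <= b ->
  a < b -> (b - a) * f c <= (b - c) * f a + (c - a) * f b.
Proof.
move=> cf ac cb ab.
have ba0 : 0 < b - a by rewrite subr_gt0.
pose p := (b - c) / (b - a).
have p0 : 0 <= p by rewrite divr_ge0 ?subr_ge0// ltW.
have p1 : p <= 1 by rewrite ler_pdivrMr// mul1r lerD2l lerN2.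
have := cf (Itv01 p0 p1) a b (mem_set Logic.I) (mem_set Logic.I).
rewrite !convRE /= /unstable.onem => h.
have E : p * a + (1 - p) * b = c by rewrite /p; field; rewrite gt_eqF.
have {}h : f c <= p * f a + (1 - p) * f b by rewrite -[X in f X <= _]E.
have := ler_wpM2l (ltW ba0) h; congr (_ <= _).
by rewrite /p; field; rewrite gt_eqF.
Qed.

Lemma minimizer_right_of_drop f m p q : convex_functions f -> minimizers f m ->
  p < q -> f q < f p -> p < m.
Proof.
move=> cf /minimizersP mf pq fqp; rewrite ltNge; apply/negP => mp.
have mq := le_lt_trans mp pq.
have h := convex_three_points cf mp (ltW pq) mq.
have h1 : 0 <= (q - p) * (f q - f m).
  by apply: mulr_ge0; rewrite subr_ge0 ?mf// ltW.
have h2 : 0 < (q - m) * (f p - f q) by rewrite mulr_gt0// subr_gt0.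
lra.
Qed.

Lemma minimizer_left_of_drop f m p q : convex_functions f -> minimizers f m ->
  q < p -> f q < f p -> m < p.
Proof.
move=> cf /minimizersP mf qp fqp; rewrite ltNge; apply/negP => pm.
have qm := lt_le_trans qp pm.
have h := convex_three_points cf (ltW qp) pm qm.
have h1 : 0 <= (p - q) * (f q - f m).
  by apply: mulr_ge0; rewrite subr_ge0 ?mf// ltW.
have h2 : 0 < (m - q) * (f p - f q) by rewrite mulr_gt0// subr_gt0.
lra.
Qed.

Lemma lt_minimizer f m p : minimizers f m -> ~ minimizers f p -> f m < f p.
Proof.
move=> /minimizersP mf np; rewrite ltNge; apply/negP => fpm; apply: np.
by apply/minimizersP => s; exact: le_trans (mf s).
Qed.

Definition drops_right D x : set (R * R) :=
  [set p | [/\ D p.1, D p.2, x < p.1 & p.1 < p.2]].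

Definition drops_left D x : set (R * R) :=
  [set p | [/\ D p.1, D p.2, p.1 < x & p.2 < p.1]].

Lemma dense_itvoo D a b : dense D -> a < b -> exists c, [/\ D c, a < c & c < b].
Proof.
move=> dD ab; have [|c [/= +Dc]] := dD `]a, b[%classic _ (itv_open a b).
  by exists ((a + b) / 2) => /=; rewrite in_itv/= !midf_lt.
by rewrite in_itv/= => /andP[ac cb]; exists c.
Qed.

(** Any [p] and [q] in [D] with [x < p < q < sigma_min f] form a drop: [p] is not
a minimizer, and moving from [p] towards a minimizer strictly decreases [f]. *)
Lemma sigma_min_gtP f D x : dense D -> S_inf f ->
  (x < sigma_min f) <-> exists2 p, drops_right D x p & f p.2 < f p.1.
Proof.
move=> dD Sf; have [mf lf] := sigma_minP Sf; have [cf _ _] := Sf.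
split=> [xs|[p [_ _ xp pq] fqp]]; last first.
  exact: lt_trans xp (minimizer_right_of_drop cf mf pq fqp).
have [p [Dp xp ps]] := dense_itvoo dD xs.
have [q [Dq pq qs]] := dense_itvoo dD ps.
exists (p, q) => //=.
have fsp : f (sigma_min f) < f p.
  by apply: lt_minimizer => // mp; have := lf _ mp; rewrite leNgt ps.
have h := convex_three_points cf (ltW pq) (ltW qs) ps.
have h2 : 0 < (q - p) * (f p - f (sigma_min f)) by rewrite mulr_gt0// subr_gt0.
rewrite -(ltr_pM2l (_ : 0 < sigma_min f - p)) ?subr_gt0//; lra.
Qed.

Lemma tau_max_ltP f D x : dense D -> S_sup f ->
  (tau_max f < x) <-> exists2 p, drops_left D x p & f p.2 < f p.1.
Proof.
move=> dD Sf; have [mf uf] := tau_maxP Sf; have [cf _ _] := Sf.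
split=> [tx|[p [_ _ px qp] fqp]]; last first.
  exact: lt_trans (minimizer_left_of_drop cf mf qp fqp) px.
have [p [Dp tp px]] := dense_itvoo dD tx.
have [q [Dq tq qp]] := dense_itvoo dD tp.
exists (p, q) => //=.
have ftp : f (tau_max f) < f p.
  by apply: lt_minimizer => // mp; have := uf _ mp; rewrite leNgt tp.
have h := convex_three_points cf (ltW tq) (ltW qp) tp.
have h2 : 0 < (p - q) * (f p - f (tau_max f)) by rewrite mulr_gt0// subr_gt0.
rewrite -(ltr_pM2l (_ : 0 < p - tau_max f)) ?subr_gt0//; lra.
Qed.

Lemma countable_drops_right D x : countable D -> countable (drops_right D x).
Proof.
move=> cD; apply: (sub_countable _ (countableX cD cD)).
by apply: subset_card_le => p [].
Qed.

Lemma countable_drops_left D x : countable D -> countable (drops_left D x).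
Proof.
move=> cD; apply: (sub_countable _ (countableX cD cD)).
by apply: subset_card_le => p [].
Qed.

End ConvexDrops.

(** * Drops under convergence of the finite dimensional distributions *)

Lemma countable_enum T (Q : set T) : countable Q ->
  Q = set0 \/ exists q : nat -> T, range q = Q.
Proof.
move=> /pfcard_geP[->|[q]]; [by left|right; exists q].
by rewrite image_eq.
Qed.

Lemma open_coord_lt (R : realType) k (i j : 'I_k) :
  open [set v : 'rV[R]_k | v ord0 i < v ord0 j].
Proof.
pose H r := ((fun v : 'rV[R]_k => v ord0 i) @^-1` `]-oo, r[) `&`
  ((fun v : 'rV[R]_k => v ord0 j) @^-1` `]r, +oo[).
rewrite (_ : [set _ | _] = \bigcup_r H r).
  apply: bigcup_open => r _; apply: openI; apply: open_comp.
  - by move=> v _; exact: coord_continuous.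
  - exact: lray_open.
  - by move=> v _; exact: coord_continuous.
  - exact: rray_open.
apply/seteqP; split=> v /=.
  move=> vij; exists ((v ord0 i + v ord0 j) / 2) => //.
  by split; rewrite /= in_itv/= ?andbT midf_lt.
move=> [r _ [/=]]; rewrite !in_itv/= andbT; exact: lt_trans.
Qed.

Section DropEvents.
Context {d} {Omega : measurableType d} {R : realType} (P : probability Omega R).
Implicit Types (Z : Omega -> R -> R) (Q : set (R * R)).

Definition drop_event Q Z : set Omega :=
  \bigcup_(p in Q) [set w | Z w p.2 < Z w p.1].

Lemma measurable_drop Z p : (forall t, measurable_fun setT (Z ^~ t)) ->
  measurable [set w | Z w p.2 < Z w p.1].
Proof.
move=> mZ.
have := measurable_fun_ltr (mZ p.2) (mZ p.1) measurableT (Y := [set true]).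
by rewrite setTI; apply.
Qed.

Lemma measurable_drop_event Z Q : (forall t, measurable_fun setT (Z ^~ t)) ->
  countable Q -> measurable (drop_event Q Z).
Proof.
move=> mZ /countable_enum[->|[q <-]]; first by rewrite /drop_event bigcup_set0.
rewrite /drop_event bigcup_image; apply: bigcup_measurable => n _.
exact: measurable_drop.
Qed.

Context {I : Type} (le : I -> I -> Prop) (D : set R).
Context (Z : Omega -> R -> R) (Za : I -> Omega -> R -> R).
Hypothesis dir : directed_set le.
Hypothesis mZ : forall t, measurable_fun setT (Z ^~ t).
Hypothesis mZa : forall a t, measurable_fun setT (Za a ^~ t).
Hypothesis fdd : forall (k : nat) (t : 'I_k -> R), (forall i, D (t i)) ->
     cvg_distribution P le (open : set (set 'rV[R]_k))
       (fun a w => \row_(i < k) Za a w (t i))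
       (fun w => \row_(i < k) Z w (t i)).

(** The [n] pairs are listed as [2n] time points: first all starting points,
then all end points.  That at least one of the pairs is a drop is then an open
condition on the vector of [2n] values. *)
Lemma tail_ge_finite_drops (q : nat -> R * R) n :
  (forall k, D (q k).1 /\ D (q k).2) ->
  let F (X : Omega -> R -> R) :=
    \big[setU/set0]_(k < n) [set w | X w (q k).2 < X w (q k).1] in
  tail_ge le (fun a => fine (P (F (Za a)))) (fine (P (F Z))).
Proof.
move=> Dq F.
pose t (i : 'I_(n + n)) :=
  match fintype.split i with inl k => (q k).1 | inr k => (q k).2 end.
have Dt i : D (t i) by rewrite /t; case: fintype.split => k; have [] := Dq k.
pose G := \bigcup_(k in [set: 'I_n])
  [set v : 'rV[R]_(n + n) | v ord0 (rshift n k) < v ord0 (lshift n k)].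
have oG : open G by apply: bigcup_open => k _; exact: open_coord_lt.
have FG X : F X = (fun w => \row_i X w (t i)) @^-1` G.
  rewrite /F.
  rewrite -(bigcup_mkord n (fun k => [set w | X w (q k).2 < X w (q k).1])).
  have fq (k : 'I_n) w : (X w (q k).2 < X w (q k).1) =
      ((\row_i X w (t i)) ord0 (rshift n k) <
       (\row_i X w (t i)) ord0 (lshift n k)).
    rewrite !mxE /t (unsplitK (inl k : 'I_n + 'I_n)%type).
    by rewrite (unsplitK (inr k : 'I_n + 'I_n)%type).
  apply/seteqP; split=> w.
    by move=> [k /= kn qk]; exists (Ordinal kn) => //=; rewrite -fq.
  by move=> [k _]; rewrite /= -fq => qk; exists k => //=.
have mF X : (forall s, measurable_fun setT (X ^~ s)) -> measurable (F X).
  by move=> mX; apply: bigsetU_measurable => k _; exact: measurable_drop.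
have [_ _ /(_ G oG)] := fdd Dt.
rewrite -FG EFin_prob; last exact: mF.
rewrite (_ : (fun a => P _) = (fun a => (fine (P (F (Za a))))%:E)).
  by move=> /net_liminf_geP.
by apply/funext => a; rewrite -FG EFin_prob//; exact: mF.
Qed.

Lemma tail_ge_drop_event Q :
  countable Q -> (forall p, Q p -> D p.1 /\ D p.2) ->
  tail_ge le (fun a => fine (P (drop_event Q (Za a))))
    (fine (P (drop_event Q Z))).
Proof.
move=> cQ QD; have [Q0|[q rq]] := countable_enum cQ.
  by apply: tail_ge_cst => // a; rewrite Q0 /drop_event !bigcup_set0.
have Eq X : drop_event Q X = \bigcup_k [set w | X w (q k).2 < X w (q k).1].
  by rewrite /drop_event -rq bigcup_image.
have Dq k : D (q k).1 /\ D (q k).2 by apply: QD; rewrite -rq; exists k.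
apply: tail_ge_approx => e e0.
have [n hn] := fine_prob_bigcup_approx P (fun k => measurable_drop (q k) mZ) e0.
rewrite -Eq in hn; eexists; first exact: hn.
apply: tail_ge_mono (tail_ge_finite_drops n Dq) => a /=.
apply: fine_prob_le; last by rewrite Eq; exact: bigsetU_bigcup.
- by apply: bigsetU_measurable => k _; exact: measurable_drop.
- exact: measurable_drop_event.
Qed.

(** Drops of the limit describe an event exactly, while along the net they need
only imply the events [Aa a]; this is what leaves the choice of a minimizer of
[Za a] free. *)
Lemma tail_ge_of_drops Q (Aa : I -> set Omega) :
  countable Q -> (forall p, Q p -> D p.1 /\ D p.2) ->
  (forall a, measurable (Aa a)) -> (forall a, drop_event Q (Za a) `<=` Aa a) ->
  tail_ge le (fun a => fine (P (Aa a))) (fine (P (drop_event Q Z))).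
Proof.
move=> cQ QD mAa QA; apply: tail_ge_mono (tail_ge_drop_event cQ QD) => a.
by apply: fine_prob_le => //; exact: measurable_drop_event.
Qed.

End DropEvents.

(** * Measurability and uniqueness of minimizers of a process *)

Section Selections.
Context {d} {Omega : measurableType d} {R : realType}.
Implicit Type Z : Omega -> R -> R.

Lemma sigma_min_preimage (D : set R) Z x : dense D -> (forall w, S_inf (Z w)) ->
  (fun w => sigma_min (Z w)) @^-1` `]x, +oo[ = drop_event (drops_right D x) Z.
Proof.
move=> dD SZ; apply/seteqP; split=> w; rewrite /= in_itv/= andbT.
  by move=> /(sigma_min_gtP _ dD (SZ w)).
by move=> [p Qp fp]; apply/(sigma_min_gtP _ dD (SZ w)); exists p.
Qed.

Lemma tau_max_preimage (D : set R) Z x : dense D -> (forall w, S_sup (Z w)) ->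
  (fun w => tau_max (Z w)) @^-1` `]-oo, x[ = drop_event (drops_left D x) Z.
Proof.
move=> dD SZ; apply/seteqP; split=> w; rewrite /= in_itv/=.
  by move=> /(tau_max_ltP _ dD (SZ w)).
by move=> [p Qp fp]; apply/(tau_max_ltP _ dD (SZ w)); exists p.
Qed.

Lemma measurable_fun_sigma_min (D : set R) Z : countable D -> dense D ->
  convex_process S_inf Z -> measurable_fun setT (fun w => sigma_min (Z w)).
Proof.
move=> cD dD [_ mZ SZ].
apply: (measurability _ (RGenOInfty.measurableE R)) => _ [_ [x ->] <-].
rewrite setTI (sigma_min_preimage _ dD)//; apply: measurable_drop_event => //.
exact: countable_drops_right.
Qed.

Lemma measurable_fun_tau_max (D : set R) Z : countable D -> dense D ->
  convex_process S_sup Z -> measurable_fun setT (fun w => tau_max (Z w)).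
Proof.
move=> cD dD [_ mZ SZ].
apply: (measurability _ (RGenInftyO.measurableE R)) => _ [_ [x ->] <-].
rewrite setTI (tau_max_preimage _ dD)//; apply: measurable_drop_event => //.
exact: countable_drops_left.
Qed.

(** As [sigma_eval] is a sigma-algebra on the set of convex functions,
complements are relative to it; they become true complements because every path of the
process is convex. *)
Lemma measurable_process_preimage (U : set (R -> R)) Z (C : set (R -> R)) :
  convex_process U Z -> sigma_eval C -> measurable (Z @^-1` C).
Proof.
move=> [cZ mZ _].
apply: (smallest_sub (X := [set C | measurable (Z @^-1` C)])).
  split=> /= [|A mA|F mF].
  - by rewrite preimage_set0.
  - rewrite (_ : Z @^-1` _ = ~` (Z @^-1` A)); first exact: measurableC.
    by apply/seteqP; split=> w /=; [case|split].
  - by rewrite preimage_bigcup; exact: bigcup_measurable.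
move=> _ [t _ [B mB <-]] /=.
rewrite (_ : Z @^-1` _ = (Z ^~ t) @^-1` B); first exact: measurable_preimage.
by apply/seteqP; split=> w /=; [case|split].
Qed.

Lemma measurable_fun_selection (xi : (R -> R) -> R) Z :
  measurable_selection xi -> convex_process S_star Z ->
  measurable_fun setT (fun w => xi (Z w)).
Proof.
move=> [mxi _] pZ _ B mB; rewrite setTI.
have [C mC CB] := mxi B mB; have [_ _ SZ] := pZ.
rewrite (_ : _ @^-1` B = Z @^-1` C).
  exact: (measurable_process_preimage pZ mC).
apply/seteqP; split=> w /=.
  by move=> Bw; have [] : (C `&` S_star) (Z w) by rewrite CB.
by move=> Cw; have [] : (S_star `&` xi @^-1` B) (Z w) by rewrite -CB.
Qed.

Lemma measure_ae_le (P : probability Omega R) (T A B : set Omega) :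
  measurable A -> measurable B -> {ae P, forall w, T w} ->
  (forall w, T w -> A w -> B w) -> (P A <= P B)%E.
Proof.
move=> mA mB [N [mN N0 TN]] TAB.
have AB : A `<=` B `|` N.
  move=> w Aw; have [Tw|nTw] := pselect (T w).
    by left; exact: TAB.
  by right; exact: TN.
have h1 : (P A <= P (B `|` N))%E.
  by apply: le_measure => //; rewrite inE//; exact: measurableU.
apply: (Order.POrderTheory.le_trans h1).
have h2 : (P (B `|` N) <= P B + P N)%E by exact: measureU2.
by rewrite N0 adde0 in h2.
Qed.

Lemma same_distribution_uniq (P : probability Omega R) (D : set R) Z :
  countable D -> dense D -> convex_process S_star Z ->
  {ae P, forall w, S_uniq (Z w)} ->
  same_distribution P (fun w => sigma_min (Z w)) (fun w => tau_max (Z w)).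
Proof.
move=> cD dD [cZ mZ SZ] uZ B mB.
have Si w : S_inf (Z w) by case: (SZ w).
have Ss w : S_sup (Z w) by case: (SZ w).
have st w : S_uniq (Z w) -> sigma_min (Z w) = tau_max (Z w).
  move=> [_ [m [_ um]]].
  by rewrite -(um _ (sigma_minP (Si w)).1) -(um _ (tau_maxP (Ss w)).1).
have ms := measurable_fun_sigma_min cD dD (And3 cZ mZ Si).
have mt := measurable_fun_tau_max cD dD (And3 cZ mZ Ss).
apply/eqP; rewrite eq_le; apply/andP; split.
  apply: measure_ae_le uZ _; try exact: measurable_preimage.
  by move=> w /st /= ->.
apply: measure_ae_le uZ _; try exact: measurable_preimage.
by move=> w /st /= ->.
Qed.

End Selections.

(** * Limits of measurable minimizers *)

Section MinimizerLimits.
Context {d} {Omega : measurableType d} {R : realType} (P : probability Omega R).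
Context {I : Type} (le : I -> I -> Prop) (D : set R).
Context (Z : Omega -> R -> R) (Za : I -> Omega -> R -> R) (X : I -> Omega -> R).
Hypothesis dir : directed_set le.
Hypothesis cD : countable D.
Hypothesis dD : dense D.
Hypothesis cZ : forall w, convex_functions (Z w).
Hypothesis mZ : forall t, measurable_fun setT (Z ^~ t).
Hypothesis cZa : forall a w, convex_functions (Za a w).
Hypothesis mZa : forall a t, measurable_fun setT (Za a ^~ t).
Hypothesis fdd : forall (k : nat) (t : 'I_k -> R), (forall i, D (t i)) ->
     cvg_distribution P le (open : set (set 'rV[R]_k))
       (fun a w => \row_(i < k) Za a w (t i))
       (fun w => \row_(i < k) Z w (t i)).
Hypothesis mX : forall a, measurable_fun setT (X a).
Hypothesis Xmin : forall a w, minimizers (Za a w) (X a w).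

Lemma tail_ge_sigma_min x : (forall w, S_inf (Z w)) ->
  tail_ge le (fun a => fine (P (X a @^-1` `]x, +oo[)))
    (fine (P ((fun w => sigma_min (Z w)) @^-1` `]x, +oo[))).
Proof.
move=> SZ; rewrite (sigma_min_preimage _ dD)//.
apply: (tail_ge_of_drops dir mZ mZa fdd (Q := drops_right D x)).
- exact: countable_drops_right.
- by move=> p [].
- by move=> a; exact: measurable_preimage.
- move=> a w [p [_ _ xp pq] fp] /=; rewrite in_itv/= andbT.
  exact: lt_trans xp (minimizer_right_of_drop (cZa a w) (Xmin a w) pq fp).
Qed.

Lemma tail_ge_tau_max x : (forall w, S_sup (Z w)) ->
  tail_ge le (fun a => fine (P (X a @^-1` `]-oo, x[)))
    (fine (P ((fun w => tau_max (Z w)) @^-1` `]-oo, x[))).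
Proof.
move=> SZ; rewrite (tau_max_preimage _ dD)//.
apply: (tail_ge_of_drops dir mZ mZa fdd (Q := drops_left D x)).
- exact: countable_drops_left.
- by move=> p [].
- by move=> a; exact: measurable_preimage.
- move=> a w [p [_ _ px qp] fp] /=; rewrite in_itv/=.
  exact: lt_trans (minimizer_left_of_drop (cZa a w) (Xmin a w) qp fp) px.
Qed.

Lemma cvg_distribution_sigma_min : (forall w, S_inf (Z w)) ->
  cvg_distribution P le O_greater X (fun w => sigma_min (Z w)).
Proof.
move=> SZ; apply: cvg_distribution_greater => //.
- exact: measurable_fun_sigma_min cD dD (And3 cZ mZ SZ).
- by move=> x; exact: tail_ge_sigma_min.
Qed.

Lemma cvg_distribution_tau_max : (forall w, S_sup (Z w)) ->
  cvg_distribution P le O_less X (fun w => tau_max (Z w)).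
Proof.
move=> SZ; apply: cvg_distribution_less => //.
- exact: measurable_fun_tau_max cD dD (And3 cZ mZ SZ).
- by move=> x; exact: tail_ge_tau_max.
Qed.

(** Equality of the laws lets each one-sided bound be read with either limit. *)
Lemma cvg_distribution_minimizers : (forall w, S_star (Z w)) ->
  same_distribution P (fun w => sigma_min (Z w)) (fun w => tau_max (Z w)) ->
  cvg_distribution P le O_natural X (fun w => sigma_min (Z w)) /\
  cvg_distribution P le O_natural X (fun w => tau_max (Z w)).
Proof.
move=> SZ st.
have Si w : S_inf (Z w) by case: (SZ w).
have Ss w : S_sup (Z w) by case: (SZ w).
split; apply: cvg_distribution_natural => //.
- exact: measurable_fun_sigma_min cD dD (And3 cZ mZ Si).
- by move=> x; exact: tail_ge_sigma_min.
- by move=> x; rewrite st//; exact: tail_ge_tau_max.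
- exact: measurable_fun_tau_max cD dD (And3 cZ mZ Ss).
- by move=> x; rewrite -st//; exact: tail_ge_sigma_min.
- by move=> x; exact: tail_ge_tau_max.
Qed.

End MinimizerLimits.

Theorem theorem7 (R : realType) (d : measure_display)
    (Omega : measurableType d) (P : probability Omega R)
    (I : Type) (le : I -> I -> Prop) (D : set R) (U : set (R -> R))
    (Z : Omega -> R -> R) (Za : I -> Omega -> R -> R) :
  directed_set le ->
  countable D -> dense D ->
  U `<=` convex_functions ->
  convex_process U Z ->
  (forall a, convex_process U (Za a)) ->
  (forall (k : nat) (t : 'I_k -> R), (forall i, D (t i)) ->
     cvg_distribution P le (open : set (set 'rV[R]_k))
       (fun a w => \row_(i < k) Za a w (t i))
       (fun w => \row_(i < k) Z w (t i))) ->
  [/\ U = S_inf ->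
        cvg_distribution P le O_greater
          (fun a w => sigma_min (Za a w)) (fun w => sigma_min (Z w)) /\
        (convex_process S_star Z -> {ae P, forall w, S_uniq (Z w)} ->
         cvg_distribution P le O_natural
           (fun a w => sigma_min (Za a w)) (fun w => sigma_min (Z w))),
      U = S_sup ->
        cvg_distribution P le O_less
          (fun a w => tau_max (Za a w)) (fun w => tau_max (Z w)) /\
        (convex_process S_star Z -> {ae P, forall w, S_uniq (Z w)} ->
         cvg_distribution P le O_natural
           (fun a w => tau_max (Za a w)) (fun w => tau_max (Z w))) &
      U = S_star ->
        forall xi : (R -> R) -> R, measurable_selection xi ->
        [/\ cvg_distribution P le O_greater
              (fun a w => xi (Za a w)) (fun w => sigma_min (Z w)),
            cvg_distribution P le O_less
              (fun a w => xi (Za a w)) (fun w => tau_max (Z w)) &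
            same_distribution P (fun w => sigma_min (Z w))
                                (fun w => tau_max (Z w)) ->
            cvg_distribution P le O_natural
              (fun a w => xi (Za a w)) (fun w => sigma_min (Z w))]].
Proof.
move=> dir cD dD _ pZ pZa fdd.
have [cZ mZ UZ] := pZ.
have cZa a w : convex_functions (Za a w) by have [] := pZa a.
have mZa a t : measurable_fun setT (Za a ^~ t) by have [] := pZa a.
split=> [US|US|US xi sxi]; subst U.
- have Xmin a w : minimizers (Za a w) (sigma_min (Za a w)).
    by have [_ _ Sa] := pZa a; exact: (sigma_minP (Sa w)).1.
  have mX a := measurable_fun_sigma_min cD dD (pZa a).
  split=> [|[_ _ SZ] uZ].
    exact: cvg_distribution_sigma_min fdd mX Xmin UZ.
  have st := same_distribution_uniq cD dD (And3 cZ mZ SZ) uZ.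
  exact: (cvg_distribution_minimizers _ _ _ _ _ _ _ fdd mX Xmin SZ st).1.
- have Xmin a w : minimizers (Za a w) (tau_max (Za a w)).
    by have [_ _ Sa] := pZa a; exact: (tau_maxP (Sa w)).1.
  have mX a := measurable_fun_tau_max cD dD (pZa a).
  split=> [|[_ _ SZ] uZ].
    exact: cvg_distribution_tau_max fdd mX Xmin UZ.
  have st := same_distribution_uniq cD dD (And3 cZ mZ SZ) uZ.
  exact: (cvg_distribution_minimizers _ _ _ _ _ _ _ fdd mX Xmin SZ st).2.
- have Xmin a w : minimizers (Za a w) (xi (Za a w)).
    by have [_ _ Sa] := pZa a; exact: sxi.2.
  have mX a := measurable_fun_selection sxi (pZa a).
  split=> [||st].
  + apply: cvg_distribution_sigma_min fdd mX Xmin _ => // w.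
    by case: (UZ w).
  + apply: cvg_distribution_tau_max fdd mX Xmin _ => // w.
    by case: (UZ w).
  + exact: (cvg_distribution_minimizers _ _ _ _ _ _ _ fdd mX Xmin UZ st).1.
Qed.
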